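(* For every finite vocabulary $V$, every mental program $\pi$ over $V$ and all $s,t\subseteq V$: $s\xrightarrow{\pi}t$ if and only if $s\cup t'\vDash\mathsf{tr}(\pi)$.
   Context: Mental programs over a finite vocabulary $V$: $\pi::=p\leftarrow\top\mid p\leftarrow\bot\mid\beta?\mid\pi\cup\pi\mid\pi;\pi\mid\pi\cap\pi$ ($p\in V$, $\beta$ a Boolean formula over $V$). For $s,t\subseteq V$: $s\xrightarrow{p\leftarrow\top}t$ iff $t=s\cup\{p\}$; $s\xrightarrow{p\leftarrow\bot}t$ iff $t=s\setminus\{p\}$; $s\xrightarrow{\beta?}t$ iff $s=t$ and $s\vDash\beta$; $\cup$ is union, $\cap$ intersection of relations, and $s\xrightarrow{\pi_1;\pi_2}t$ iff some $u\subseteq V$ has $s\xrightarrow{\pi_1}u$ and $u\xrightarrow{\pi_2}t$. $V'=\{p'\mid p\in V\}$ and $V''=\{p''\mid p\in V\}$ are fresh copies of $V$, $t'=\{p'\mid p\in t\}$; Boolean formulas over $V\cup V'$ are evaluated at subsets of $V\cup V'$. $[A\mapsto B]\phi$ is simultaneous substitution via the evident bijection; $\exists p\,\phi:=[p\mapsto\top]\phi\lor[p\mapsto\bot]\phi$, extended to sets. The translation $\mathsf{tr}$ to Boolean formulas over $V\cup V'$: $\mathsf{tr}(p\leftarrow\top)=p'\land\bigwedge_{q\in V,q\neq p}(q\leftrightarrow q')$; $\mathsf{tr}(p\leftarrow\bot)=\neg p'\land\bigwedge_{q\in V,q\neq p}(q\leftrightarrow q')$; $\mathsf{tr}(\beta?)=\beta\land\bigwedge_{p\in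 V}(p\leftrightarrow p')$; $\mathsf{tr}(\pi_1\cup\pi_2)=\mathsf{tr}(\pi_1)\lor\mathsf{tr}(\pi_2)$; $\mathsf{tr}(\pi_1\cap\pi_2)=\mathsf{tr}(\pi_1)\land\mathsf{tr}(\pi_2)$; $\mathsf{tr}(\pi_1;\pi_2)=[V''\mapsto V'](\exists V'(\mathsf{tr}(\pi_1)\land\mathsf{tr}(\pi_2)'))$, where $\mathsf{tr}(\pi_2)'$ is obtained from $\mathsf{tr}(\pi_2)$ by simultaneously replacing each $p\in V$ by $p'$ and each $p'\in V'$ by $p''$. *)

(* Defs.v *)
From mathcomp Require Import all_boot.

Set Implicit Arguments.
Unset Strict Implicit.
Unset Printing Implicit Defensive.

Inductive form (A : Type) : Type :=
| FAtom of A
| FTop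
| FBot
| FNeg of form A
| FAnd of form A & form A
| FOr of form A & form A
| FImp of form A & form A
| FIff of form A & form A.

Arguments FTop {A}.
Arguments FBot {A}.

Fixpoint sat (A : finType) (v : {set A}) (phi : form A) : bool :=
  match phi with
  | FAtom p => p \in v
  | FTop => true
  | FBot => false
  | FNeg f => ~~ sat v f
  | FAnd f g => sat v f && sat v g
  | FOr f g => sat v f || sat v g
  | FImp f g => sat v f ==> sat v g
  | FIff f g => sat v f == sat v g
  end.

(* Simultaneous substitution; [sigma] is the identity ([FAtom]) on the atoms
   that are not replaced. *)
Fixpoint subst (A B : Type) (sigma : A -> form B) (phi : form A) : form B :=
  match phi with
  | FAtom p => sigma p
  | FTop => FTop
  | FBot => FBot
  | FNeg f => FNeg (subst sigma f)
  | FAnd f g => FAnd (subst sigma f) (subst sigma g)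
  | FOr f g => FOr (subst sigma f) (subst sigma g)
  | FImp f g => FImp (subst sigma f) (subst sigma g)
  | FIff f g => FIff (subst sigma f) (subst sigma g)
  end.

Definition rename (A B : Type) (r : A -> B) (phi : form A) : form B :=
  subst (fun p => FAtom (r p)) phi.

Definition subst1 (A : eqType) (p : A) (chi phi : form A) : form A :=
  subst (fun q => if q == p then chi else FAtom q) phi.

Definition fexists (A : eqType) (p : A) (phi : form A) : form A :=
  FOr (subst1 p FTop phi) (subst1 p FBot phi).

Definition fexists_seq (A : eqType) (ps : seq A) (phi : form A) : form A :=
  foldr (@fexists A) phi ps.

Inductive program (V : Type) : Type :=
| AssignTop of V
| AssignBot of V
| Test of form V
| Union of program V & program V
| Seq of program V & program V
| Inter of program V & program V.

Fixpoint step (V : finType) (pi : program V) (s t : {set V}) : Prop :=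
  match pi with
  | AssignTop p => t = s :|: [set p]
  | AssignBot p => t = s :\: [set p]
  | Test beta => s = t /\ sat s beta
  | Union pi1 pi2 => step pi1 s t \/ step pi2 s t
  | Seq pi1 pi2 => exists u : {set V}, step pi1 s u /\ step pi2 u t
  | Inter pi1 pi2 => step pi1 s t /\ step pi2 s t
  end.

(* V ∪ V' is the disjoint sum V + V:  p = inl p  and  p' = inr p.
   V ∪ V' ∪ V'' is (V + V) + V:  p = inl (inl p),  p' = inl (inr p)  and
   p'' = inr p,  so that inl is the inclusion of V ∪ V' into V ∪ V' ∪ V''. *)
Notation atom2 V := (V + V)%type.
Notation atom3 V := (V + V + V)%type.

Definition base (V : Type) (p : V) : atom2 V := inl p.
Definition primed (V : Type) (p : V) : atom2 V := inr p.

(* p |-> p'  and  p' |-> p'' *)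
Definition shift (V : Type) (x : atom2 V) : atom3 V :=
  match x with
  | inl p => inl (inr p)
  | inr p => inr p
  end.

(* [V'' |-> V']: identity on V ∪ V', and p'' |-> p'. *)
Definition dprime_to_prime (V : Type) (x : atom3 V) : atom2 V :=
  match x with
  | inl y => y
  | inr p => inr p
  end.

Definition same (V : Type) (p : V) : form (atom2 V) :=
  FIff (FAtom (base p)) (FAtom (primed p)).

Fixpoint tr (V : finType) (pi : program V) : form (atom2 V) :=
  match pi with
  | AssignTop p =>
      FAnd (FAtom (primed p)) (\big[@FAnd _/FTop]_(q : V | q != p) same q)
  | AssignBot p =>
      FAnd (FNeg (FAtom (primed p))) (\big[@FAnd _/FTop]_(q : V | q != p) same q)
  | Test beta =>
      FAnd (rename (@base V) beta) (\big[@FAnd _/FTop]_(p : V) same p)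
  | Union pi1 pi2 => FOr (tr pi1) (tr pi2)
  | Inter pi1 pi2 => FAnd (tr pi1) (tr pi2)
  | Seq pi1 pi2 =>
      rename (@dprime_to_prime V)
        (fexists_seq [seq inl (primed p) | p <- enum V]
          (FAnd (rename (fun x : atom2 V => inl x : atom3 V) (tr pi1))
                (rename (@shift V) (tr pi2))))
  end.

(* s ∪ t' *)
Definition pair_val (V : finType) (s t : {set V}) : {set atom2 V} :=
  [set base p | p in s] :|: [set primed p | p in t].

(* Main.v *)
Require Import Defs.
From mathcomp Require Import all_boot.

(** Satisfaction commutes with substitution once the valuation is pulled back
    along it; hence [fexists_seq ps] ranges over the valuations that differ from
    the current one on [ps] only.  For a composition, [[V'' |-> V']] pulls
    [s ∪ t'] back to [s ∪ t' ∪ t''], quantifying over [V'] there amounts to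
    choosing the intermediate state [u], and the pullbacks of [s ∪ u' ∪ t''],
    encoded as [sum_val (sum_val s u) t], along the two renamings under the
    quantifier are [s ∪ u'] and [u ∪ t']. *)

Section Satisfaction.
Variable A : finType.
Implicit Types (v : {set A}) (phi chi : form A).

Lemma sat_subst (B : finType) (sigma : A -> form B) (v : {set B}) phi :
  sat v (subst sigma phi) = sat [set a | sat v (sigma a)] phi.
Proof.
by elim: phi => [p|||f IHf|f IHf g IHg|f IHf g IHg|f IHf g IHg|f IHf g IHg] //=;
  rewrite ?inE ?IHf ?IHg.
Qed.

Lemma sat_rename (B : finType) (r : A -> B) (v : {set B}) phi :
  sat v (rename r phi) = sat (r @^-1: v) phi.
Proof. exact: sat_subst. Qed.

Lemma sat_bigand (I : Type) (r : seq I) (P : pred I) (F : I -> form A) v :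
  sat v (\big[@FAnd A/FTop]_(i <- r | P i) F i) =
  \big[andb/true]_(i <- r | P i) sat v (F i).
Proof. exact: big_morph. Qed.

Lemma sat_subst1 (p : A) chi phi v :
  sat v (subst1 p chi phi) = sat (if sat v chi then p |: v else v :\ p) phi.
Proof.
rewrite sat_subst; congr (sat _ _); apply/setP => q; rewrite inE.
by have [->|qp] := eqVneq q p; case: ifP => v_chi;
  rewrite !inE ?eqxx ?(negbTE qp).
Qed.

Lemma sat_fexists (p : A) phi v :
  sat v (fexists p phi) = sat (p |: v) phi || sat (v :\ p) phi.
Proof. by rewrite /= !sat_subst1. Qed.

Lemma sat_fexists_seqP (ps : seq A) phi v :
  reflect (exists2 w : {set A}, {in [predC ps], w =i v} & sat w phi)
          (sat v (fexists_seq ps phi)).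
Proof.
elim: ps v => [|p ps IHps] v.
  apply: (iffP idP) => [sat_v|[w eq_wv]]; first by exists v.
  by have -> : w = v by apply/setP => x; apply: eq_wv.
rewrite -[fexists_seq _ _]/(fexists p (fexists_seq ps phi)) sat_fexists.
apply: (iffP orP) => [sat_v|[w eq_wv sat_w]].
  by case: sat_v => /IHps[w eq_wv sat_w]; exists w => // x;
    rewrite !inE negb_or => /andP[/negbTE xp /eq_wv->]; rewrite !inE xp.
have eq_wv_off x : x \notin ps -> x != p -> (x \in w) = (x \in v).
  by move=> x_ps xp; apply: eq_wv; rewrite !inE negb_or xp.
have [pw|/negbTE pw] := boolP (p \in w); [left | right];
  apply/IHps; exists w => // x x_ps; rewrite !inE;
  by have [->|xp] := eqVneq x p; rewrite ?pw ?eq_wv_off.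
Qed.

End Satisfaction.

Section DisjointUnion.
Variables A B : finType.
Implicit Types (v : {set A}) (w : {set B}).

Definition sum_val v w : {set A + B} :=
  [set inl a | a in v] :|: [set inr b | b in w].

Lemma in_sum_val_inl v w a : (inl a \in sum_val v w) = (a \in v).
Proof. by rewrite inE (mem_imset _ _ inl_inj) orbC; case: imsetP => // -[]. Qed.

Lemma in_sum_val_inr v w b : (inr b \in sum_val v w) = (b \in w).
Proof. by rewrite inE (mem_imset _ _ inr_inj); case: imsetP => // -[]. Qed.

Definition in_sum_val := (in_sum_val_inl, in_sum_val_inr).

Lemma preimset_inl_sum_val v w : inl @^-1: sum_val v w = v.
Proof. by apply/setP => a; rewrite inE in_sum_val. Qed.

End DisjointUnion.

Arguments sum_val {A B} v w.

Lemma eqset_bigand (T : finType) (A B : {set T}) :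
  (A == B) = \big[andb/true]_x ((x \in A) == (x \in B)).
Proof.
by rewrite big_andE; apply/eqP/forall_inP => [-> //|eqAB]; apply/setP => x;
  apply/eqP/eqAB.
Qed.

Section Translation.
Variable V : finType.
Implicit Types (s t u : {set V}) (p : V) (pi : program V).

Lemma pair_valE s t : pair_val s t = sum_val s t.
Proof. by []. Qed.

Lemma preimset_shift s t u :
  @shift V @^-1: sum_val (sum_val s u) t = sum_val u t.
Proof. by apply/setP => -[] p; rewrite inE /= !in_sum_val. Qed.

Lemma preimset_dprime_to_prime s t :
  @dprime_to_prime V @^-1: sum_val s t = sum_val (sum_val s t) t.
Proof. by apply/setP => -[x|p]; rewrite inE /= !in_sum_val. Qed.

Lemma sat_fexists_primed s t u (phi : form (atom3 V)) :
  sat (sum_val (sum_val s u) t)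
      (fexists_seq [seq inl (primed p) | p <- enum V] phi) =
  [exists u', sat (sum_val (sum_val s u') t) phi].
Proof.
apply/sat_fexists_seqP/existsP => [[w eq_wv sat_w]|[u' sat_u']].
  exists [set p | inl (primed p) \in w].
  suff -> : sum_val (sum_val s [set p | inl (primed p) \in w]) t = w by [].
  apply/setP => -[[p|p]|p]; rewrite !in_sum_val ?inE //;
    by rewrite eq_wv ?in_sum_val // inE; apply/mapP => -[].
exists (sum_val (sum_val s u') t) => // -[[p|p]|p]; rewrite !in_sum_val //.
by rewrite inE /= (map_f (fun q => inl (primed q))) ?mem_enum.
Qed.

Lemma sat_big_same (P : pred V) s t :
  sat (pair_val s t) (\big[@FAnd _/FTop]_(p | P p) same p) =
  \big[andb/true]_(p | P p) ((p \in s) == (p \in t)).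
Proof.
by rewrite sat_bigand; apply: eq_bigr => p _; rewrite /= pair_valE !in_sum_val.
Qed.

Lemma sat_tr_AssignTop p s t :
  sat (pair_val s t) (tr (AssignTop p)) = (t == s :|: [set p]).
Proof.
rewrite /= sat_big_same pair_valE in_sum_val eqset_bigand [RHS](bigD1 p) //=.
rewrite !inE eqxx orbT eqb_id; congr (_ && _).
by apply: eq_bigr => q /negbTE qp; rewrite !inE qp orbF eq_sym.
Qed.

Lemma sat_tr_AssignBot p s t :
  sat (pair_val s t) (tr (AssignBot p)) = (t == s :\: [set p]).
Proof.
rewrite /= sat_big_same pair_valE in_sum_val eqset_bigand [RHS](bigD1 p) //=.
rewrite !inE eqxx eqbF_neg; congr (_ && _).
by apply: eq_bigr => q qp; rewrite !inE qp eq_sym.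
Qed.

Lemma sat_tr_Test (beta : form V) s t :
  sat (pair_val s t) (tr (Test beta)) = (s == t) && sat s beta.
Proof.
by rewrite /= sat_big_same sat_rename preimset_inl_sum_val -eqset_bigand andbC.
Qed.

Lemma sat_tr_Seq pi1 pi2 s t :
  sat (pair_val s t) (tr (Seq pi1 pi2)) =
  [exists u, sat (pair_val s u) (tr pi1) && sat (pair_val u t) (tr pi2)].
Proof.
rewrite /= sat_rename preimset_dprime_to_prime sat_fexists_primed.
apply: eq_existsb => u.
by rewrite /= !sat_rename preimset_inl_sum_val preimset_shift.
Qed.

End Translation.

Theorem theorem12 (V : finType) (pi : program V) (s t : {set V}) :
  step pi s t <-> sat (pair_val s t) (tr pi).
Proof.
apply: rwP.
elim: pi s t => [p|p|beta|pi1 IH1 pi2 IH2|pi1 IH1 pi2 IH2|pi1 IH1 pi2 IH2] s t.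
- by rewrite sat_tr_AssignTop; apply: eqP.
- by rewrite sat_tr_AssignBot; apply: eqP.
- by rewrite sat_tr_Test; apply: andPP eqP idP.
- exact: orPP.
- by rewrite sat_tr_Seq; apply: existsPP => u; apply: andPP.
- exact: andPP.
Qed.
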